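(* Consider the $s$-stage mean-square partitioned Runge-Kutta method $$Q_i=q_k+\Delta t\sum_{j=1}^s a_{ij}\frac{\partial H}{\partial p}(Q_j,P_j)+\sum_{r=1}^m\Delta W^r\sum_{j=1}^s b_{ij}\frac{\partial h_r}{\partial p}(Q_j,P_j),\quad i=1,\ldots,s,$$ $$P_i=p_k-\Delta t\sum_{j=1}^s\bar a_{ij}\frac{\partial H}{\partial q}(Q_j,P_j)-\sum_{r=1}^m\Delta W^r\sum_{j=1}^s\bar b_{ij}\frac{\partial h_r}{\partial q}(Q_j,P_j)+\Delta t\sum_{j=1}^s\hat a_{ij}F(Q_j,P_j)+\sum_{r=1}^m\Delta W^r\sum_{j=1}^s\hat b_{ij}f_r(Q_j,P_j),\quad i=1,\ldots,s,$$ $$q_{k+1}=q_k+\Delta t\sum_{i=1}^s\alpha_i\frac{\partial H}{\partial p}(Q_i,P_i)+\sum_{r=1}^m\Delta W^r\sum_{i=1}^s\beta_i\frac{\partial h_r}{\partial p}(Q_i,P_i),$$ $$p_{k+1}=p_k-\Delta t\sum_{i=1}^s\alpha_i\frac{\partial H}{\partial q}(Q_i,P_i)-\sum_{r=1}^m\Delta W^r\sum_{i=1}^s\beta_i\frac{\partial h_r}{\partial q}(Q_i,P_i)+\Delta t\sum_{i=1}^s\hat\alpha_iF(Q_i,P_i)+\sum_{r=1}^m\Delta W^r\sum_{i=1}^s\hat\beta_if_r(Q_i,P_i),$$ whose real coefficients satisfy, for all $i,j=1,\ldots,s$, $$\alpha_i\bar a_{ij}+\alpha_ja_{ji}=\alpha_i\alpha_j,\quad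 \beta_i\bar b_{ij}+\beta_jb_{ji}=\beta_i\beta_j,\quad \beta_i\bar a_{ij}+\alpha_jb_{ji}=\beta_i\alpha_j,\quad \alpha_i\bar b_{ij}+\beta_ja_{ji}=\alpha_i\beta_j,$$ $$\alpha_i\hat a_{ij}+\hat\alpha_ja_{ji}=\alpha_i\hat\alpha_j,\quad \alpha_i\hat b_{ij}+\hat\beta_ja_{ji}=\alpha_i\hat\beta_j,\quad \beta_i\hat a_{ij}+\hat\alpha_jb_{ji}=\beta_i\hat\alpha_j,\quad \beta_i\hat b_{ij}+\hat\beta_jb_{ji}=\beta_i\hat\beta_j.$$ Then this method is a stochastic Lagrange-d'Alembert variational integrator, i.e. it satisfies $$q_{k+1}=D_2H^+_d(q_k,p_{k+1})-F^+_d(q_k,p_{k+1}),\qquad p_k=D_1H^+_d(q_k,p_{k+1})-F^-_d(q_k,p_{k+1}),$$ with the discrete Hamiltonian $$H^+_d(q_k,p_{k+1})=p_{k+1}q_{k+1}-\Delta t\sum_{i=1}^s\alpha_i\Big(P_i\frac{\partial H}{\partial p}(Q_i,P_i)-H(Q_i,P_i)\Big)-\sum_{r=1}^m\Delta W^r\sum_{i=1}^s\beta_i\Big(P_i\frac{\partial h_r}{\partial p}(Q_i,P_i)-h_r(Q_i,P_i)\Big)$$ and the discrete forces $$F^-_d(q_k,p_{k+1})=\Delta t\sum_{i=1}^s\hat\alpha_i\Big(\frac{\partial Q_i}{\partial q_k}\Big)^TF(Q_i,P_i)+\sum_{r=1}^m\Delta W^r\sum_{i=1}^s\hat\beta_i\Big(\frac{\partial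 Q_i}{\partial q_k}\Big)^Tf_r(Q_i,P_i),$$ $$F^+_d(q_k,p_{k+1})=\Delta t\sum_{i=1}^s\hat\alpha_i\Big(\frac{\partial Q_i}{\partial p_{k+1}}\Big)^TF(Q_i,P_i)+\sum_{r=1}^m\Delta W^r\sum_{i=1}^s\hat\beta_i\Big(\frac{\partial Q_i}{\partial p_{k+1}}\Big)^Tf_r(Q_i,P_i),$$ where $q_{k+1}$, $p_k$, $Q_i$, $P_i$ satisfy the Runge-Kutta equations above and are understood as functions of $q_k$ and $p_{k+1}$.
   Context: The method discretizes the stochastic forced Hamiltonian system on $T^*Q\cong\mathbb{R}^N\times\mathbb{R}^N$ $$d_t q = \frac{\partial H}{\partial p}\,dt + \sum_{r=1}^m\frac{\partial h_r}{\partial p}\circ dW^r(t),\qquad d_t p = \Big[-\frac{\partial H}{\partial q} + F(q,p)\Big] dt + \sum_{r=1}^m \Big[-\frac{\partial h_r}{\partial q}+f_r(q,p)\Big]\circ dW^r(t),$$ where $H,h_1,\ldots,h_m:\mathbb{R}^N\times\mathbb{R}^N\to\mathbb{R}$, $F,f_1,\ldots,f_m:\mathbb{R}^N\times\mathbb{R}^N\to\mathbb{R}^N$, $W=(W^1,\ldots,W^m)$ is a standard Wiener process, and $\circ$ denotes Stratonovich integration. Standing assumptions: $H$ and all $h_r$ are $C^2$, $F$ and all $f_r$ are $C^1$, and the drift and diffusion coefficients of the It\^o form of the system are globally Lipschitz. $\Delta t>0$ is the time step, $\Delta W^r=W^r(t_{k+1})-W^r(t_k)$ are the Wiener increments over the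 step, and $Q_i,P_i\in\mathbb{R}^N$ are internal stages. Products of vectors such as $p_{k+1}q_{k+1}$ and $P_i\frac{\partial H}{\partial p}$ are scalar products; $D_1,D_2$ are the (column-vector) derivatives with respect to the first argument $q_k$ and second argument $p_{k+1}$; $\partial Q_i/\partial q_k$ and $\partial Q_i/\partial p_{k+1}$ are Jacobian matrices. *)

(* Defs.v *)
From HB Require Import structures.
From mathcomp Require Import all_boot all_order all_algebra.
From mathcomp Require Import all_classical all_reals all_analysis.

Set Implicit Arguments.
Unset Strict Implicit.
Unset Printing Implicit Defensive.

Import Order.TTheory GRing.Theory Num.Theory.
Import numFieldNormedType.Exports.

Local Open Scope classical_set_scope.
Local Open Scope ring_scope.

(* T^*Q = R^N x R^N, with points (q, p); vectors are columns. *)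
Notation phase R N := ('cV[R]_N * 'cV[R]_N)%type.

Definition dotv (R : realType) (N : nat) (u v : 'cV[R]_N) : R :=
  \sum_(i < N) u i 0 * v i 0.

(* Gradients with respect to the first and to the second vector argument. *)
Definition grad1 (R : realType) (N : nat) (g : phase R N -> R)
    (z : phase R N) : 'cV[R]_N :=
  \col_j 'D_(delta_mx j 0, 0) g z.

Definition grad2 (R : realType) (N : nat) (g : phase R N -> R)
    (z : phase R N) : 'cV[R]_N :=
  \col_j 'D_(0, delta_mx j 0) g z.

(* Jacobian matrices in the usual convention, entry (i, j) being the partial
   derivative of component i with respect to variable j; the library's
   [jacobian], which acts on row vectors, is the transpose of this. *)
Definition jac1 (R : realType) (N : nat) (g : phase R N -> 'cV[R]_N)
    (z : phase R N) : 'M[R]_N :=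
  \matrix_(i, j) 'D_(delta_mx j 0, 0) (fun y => g y i 0 : R) z.

Definition jac2 (R : realType) (N : nat) (g : phase R N -> 'cV[R]_N)
    (z : phase R N) : 'M[R]_N :=
  \matrix_(i, j) 'D_(0, delta_mx j 0) (fun y => g y i 0 : R) z.

(* On a finite-dimensional domain, continuity of every directional derivative
   is continuity of the differential. *)
Definition C1 (R : realType) (V W : normedModType R) (g : V -> W) : Prop :=
  (forall x, differentiable g x) /\ (forall v, continuous ('D_v g)).

Definition C2 (R : realType) (V W : normedModType R) (g : V -> W) : Prop :=
  C1 g /\ (forall v, C1 ('D_v g)).

Record forced_system (R : realType) (N m : nat) := ForcedSystem {
  ham : phase R N -> R;
  sham : 'I_m -> phase R N -> R;
  force : phase R N -> 'cV[R]_N;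
  sforce : 'I_m -> phase R N -> 'cV[R]_N }.

Definition strat_drift (R : realType) (N m : nat) (sys : forced_system R N m)
    (z : phase R N) : phase R N :=
  (grad2 (ham sys) z, - grad1 (ham sys) z + force sys z).

Definition diffusion (R : realType) (N m : nat) (sys : forced_system R N m)
    (r : 'I_m) (z : phase R N) : phase R N :=
  (grad2 (sham sys r) z, - grad1 (sham sys r) z + sforce sys r z).

(* Stratonovich-to-Ito conversion: half the sum of the derivatives of the
   diffusion coefficients along themselves is added to the drift. *)
Definition ito_drift (R : realType) (N m : nat) (sys : forced_system R N m)
    (z : phase R N) : phase R N :=
  strat_drift sys z
  + 2^-1 *: \sum_(r < m) 'd (diffusion sys r) z (diffusion sys r z).

Definition standing_assumptions (R : realType) (N m : nat)
    (sys : forced_system R N m) : Prop :=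
  [/\ C2 (ham sys) /\ (forall r, C2 (sham sys r)),
      C1 (force sys) /\ (forall r, C1 (sforce sys r)),
      lipschitz (ito_drift sys) &
      forall r, lipschitz (diffusion sys r)].

(* Since the events may be the whole line, this is the product rule over every
   subfamily. *)
Definition mutually_independent d (T : measurableType d) (R : realType)
    (P : probability T R) (I : finType) (X : I -> T -> R) : Prop :=
  forall B : I -> set R, (forall i, measurable (B i)) ->
    P (\bigcap_(i in [set: I]) (X i @^-1` B i)) =
    (\prod_(i in I) P (X i @^-1` B i))%E.

(* Only times t >= 0 are constrained. The last clause expresses both the
   independence of increments over successive time intervals and that of the
   components. *)
Definition standard_wiener d (T : measurableType d) (R : realType)
    (P : probability T R) (m : nat) (W : 'I_m -> R -> {RV P >-> R}) : Prop :=
  [/\ {ae P, forall omega, forall r, W r 0 omega = 0},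
      {ae P, forall omega, forall r,
        {within `[0, +oo[, continuous (fun t => W r t omega)}},
      forall r (t u : R), 0 <= t -> t < u ->
        forall B : set R, measurable B ->
        P ((fun omega => W r u omega - W r t omega) @^-1` B) =
        normal_prob 0 (Num.sqrt (u - t)) B &
      forall (n : nat) (t : nat -> R), 0 <= t 0%N ->
        {homo t : i j / (i <= j)%N >-> i <= j} ->
        mutually_independent P (fun (rj : 'I_m * 'I_n) (omega : T) =>
          W rj.1 (t rj.2.+1) omega - W rj.1 (t rj.2) omega)].

(* a, alpha go with the time step and b, beta with the Wiener increments; bars
   belong to the Hamiltonian terms and hats to the forcing terms of the momentum
   equations. *)
Record prk_tableau (R : realType) (s : nat) := PrkTableau {
  coef_a : 'M[R]_s; coef_abar : 'M[R]_s; coef_ahat : 'M[R]_s;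
  coef_b : 'M[R]_s; coef_bbar : 'M[R]_s; coef_bhat : 'M[R]_s;
  coef_alpha : 'I_s -> R; coef_alphahat : 'I_s -> R;
  coef_beta : 'I_s -> R; coef_betahat : 'I_s -> R }.

Definition prk_conditions (R : realType) (s : nat) (C : prk_tableau R s) :
    Prop :=
  forall i j : 'I_s,
  [/\ coef_alpha C i * coef_abar C i j + coef_alpha C j * coef_a C j i
        = coef_alpha C i * coef_alpha C j,
      coef_beta C i * coef_bbar C i j + coef_beta C j * coef_b C j i
        = coef_beta C i * coef_beta C j,
      coef_beta C i * coef_abar C i j + coef_alpha C j * coef_b C j i
        = coef_beta C i * coef_alpha C j &
      coef_alpha C i * coef_bbar C i j + coef_beta C j * coef_a C j i
        = coef_alpha C i * coef_beta C j] /\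
  [/\ coef_alpha C i * coef_ahat C i j + coef_alphahat C j * coef_a C j i
        = coef_alpha C i * coef_alphahat C j,
      coef_alpha C i * coef_bhat C i j + coef_betahat C j * coef_a C j i
        = coef_alpha C i * coef_betahat C j,
      coef_beta C i * coef_ahat C i j + coef_alphahat C j * coef_b C j i
        = coef_beta C i * coef_alphahat C j &
      coef_beta C i * coef_bhat C i j + coef_betahat C j * coef_b C j i
        = coef_beta C i * coef_betahat C j].

(* One step from (q0, p0) to (q1, p1) with internal stages Q, P. *)
Definition prk_step (R : realType) (N m s : nat) (sys : forced_system R N m)
    (C : prk_tableau R s) (dt : R) (dW : 'I_m -> R)
    (Q P : 'I_s -> 'cV[R]_N) (q0 p0 q1 p1 : 'cV[R]_N) : Prop :=
  [/\ forall i, Q i = q0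
        + dt *: \sum_(j < s) coef_a C i j *: grad2 (ham sys) (Q j, P j)
        + \sum_(r < m) dW r *:
            \sum_(j < s) coef_b C i j *: grad2 (sham sys r) (Q j, P j),
      forall i, P i = p0
        - dt *: \sum_(j < s) coef_abar C i j *: grad1 (ham sys) (Q j, P j)
        - \sum_(r < m) dW r *:
            \sum_(j < s) coef_bbar C i j *: grad1 (sham sys r) (Q j, P j)
        + dt *: \sum_(j < s) coef_ahat C i j *: force sys (Q j, P j)
        + \sum_(r < m) dW r *:
            \sum_(j < s) coef_bhat C i j *: sforce sys r (Q j, P j),
      q1 = q0
        + dt *: \sum_(i < s) coef_alpha C i *: grad2 (ham sys) (Q i, P i)
        + \sum_(r < m) dW r *:
            \sum_(i < s) coef_beta C i *: grad2 (sham sys r) (Q i, P i) &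
      p1 = p0
        - dt *: \sum_(i < s) coef_alpha C i *: grad1 (ham sys) (Q i, P i)
        - \sum_(r < m) dW r *:
            \sum_(i < s) coef_beta C i *: grad1 (sham sys r) (Q i, P i)
        + dt *: \sum_(i < s) coef_alphahat C i *: force sys (Q i, P i)
        + \sum_(r < m) dW r *:
            \sum_(i < s) coef_betahat C i *: sforce sys r (Q i, P i)].

(* Below, z = (q_k, p_{k+1}), and the stages Q, P as well as q1 = q_{k+1} are
   functions of z. *)
Definition discrete_hamiltonian (R : realType) (N m s : nat)
    (sys : forced_system R N m) (C : prk_tableau R s) (dt : R) (dW : 'I_m -> R)
    (Q P : 'I_s -> phase R N -> 'cV[R]_N) (q1 : phase R N -> 'cV[R]_N)
    (z : phase R N) : R :=
  dotv z.2 (q1 z)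
  - dt * \sum_(i < s) coef_alpha C i *
      (dotv (P i z) (grad2 (ham sys) (Q i z, P i z)) - ham sys (Q i z, P i z))
  - \sum_(r < m) dW r * \sum_(i < s) coef_beta C i *
      (dotv (P i z) (grad2 (sham sys r) (Q i z, P i z))
       - sham sys r (Q i z, P i z)).

Definition discrete_force_minus (R : realType) (N m s : nat)
    (sys : forced_system R N m) (C : prk_tableau R s) (dt : R) (dW : 'I_m -> R)
    (Q P : 'I_s -> phase R N -> 'cV[R]_N) (z : phase R N) : 'cV[R]_N :=
  dt *: \sum_(i < s) coef_alphahat C i *:
      ((jac1 (Q i) z)^T *m force sys (Q i z, P i z))
  + \sum_(r < m) dW r *: \sum_(i < s) coef_betahat C i *:
      ((jac1 (Q i) z)^T *m sforce sys r (Q i z, P i z)).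

Definition discrete_force_plus (R : realType) (N m s : nat)
    (sys : forced_system R N m) (C : prk_tableau R s) (dt : R) (dW : 'I_m -> R)
    (Q P : 'I_s -> phase R N -> 'cV[R]_N) (z : phase R N) : 'cV[R]_N :=
  dt *: \sum_(i < s) coef_alphahat C i *:
      ((jac2 (Q i) z)^T *m force sys (Q i z, P i z))
  + \sum_(r < m) dW r *: \sum_(i < s) coef_betahat C i *:
      ((jac2 (Q i) z)^T *m sforce sys r (Q i z, P i z)).

(* [grad1] and [grad2] are total, so differentiability of the discrete
   Hamiltonian is required explicitly. *)
Definition lagrange_dAlembert_integrator (R : realType) (N : nat)
    (Hd : phase R N -> R) (Fminus Fplus : phase R N -> 'cV[R]_N)
    (U : set (phase R N)) (p0 q1 : phase R N -> 'cV[R]_N) : Prop :=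
  forall z, U z ->
  [/\ differentiable Hd z,
      q1 z = grad2 Hd z - Fplus z &
      p0 z = grad1 Hd z - Fminus z].

(* Main.v *)
(* Absorbing the time step and the Wiener increments into the coefficients
   turns one step into a single deterministic partitioned Runge-Kutta step with
   coefficients a, abar, ahat, alpha, alphahat indexed by pairs
   (driving process, stage). Write X, Y, F for dh/dp, dh/dq and the force at
   the stages, and put Z_y = alphahat_y F_y - alpha_y Y_y. The order conditions imply that
     alpha_x (p_{k+1} - P_x) = sum_y a_yx Z_y,
   while p_{k+1} = p_k + sum_y Z_y. In the derivative of H_d^+ along v the terms
   X . DP cancel, and exchanging sums and using
   DQ_y = v.1 + sum_x a_yx DX_x turn the remaining terms into
     v.2 . q_{k+1} + p_k . v.1 + sum_y alphahat_y F_y . DQ_y,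
   whose last sum is the work of the discrete forces. *)
Require Import Defs.
From HB Require Import structures.
From mathcomp Require Import all_boot all_order all_algebra.
From mathcomp Require Import all_classical all_reals all_analysis.

Set Implicit Arguments.
Unset Strict Implicit.
Unset Printing Implicit Defensive.

Import Order.TTheory GRing.Theory Num.Theory.
Import numFieldNormedType.Exports.

Local Open Scope classical_set_scope.
Local Open Scope ring_scope.

(** * Finite sums and the scalar product of columns *)

Lemma big_option (V : nmodType) (I : finType) (F : option I -> V) :
  \sum_k F k = F None + \sum_i F (Some i).
Proof.
rewrite (bigD1 None) //=; congr (_ + _).
rewrite (reindex_omap (Some : I -> option I) id) /=; last by case.
by apply: eq_bigl => i; rewrite eqxx.
Qed.

Section DotProduct.
Variables (R : realType) (N : nat).
Implicit Types u v w : 'cV[R]_N.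

Lemma dotvC u v : dotv u v = dotv v u.
Proof. by apply: eq_bigr => i _; rewrite mulrC. Qed.

Lemma dotvDl u v w : dotv (u + v) w = dotv u w + dotv v w.
Proof. by rewrite -big_split; apply: eq_bigr => i _; rewrite mxE mulrDl. Qed.

Lemma dotvZl c u v : dotv (c *: u) v = c * dotv u v.
Proof. by rewrite mulr_sumr; apply: eq_bigr => i _; rewrite mxE mulrA. Qed.

Lemma dotvBl u v w : dotv (u - v) w = dotv u w - dotv v w.
Proof. by rewrite dotvDl -scaleN1r dotvZl mulN1r. Qed.

Lemma dotv_suml (I : finType) (F : I -> 'cV[R]_N) v :
  dotv (\sum_i F i) v = \sum_i dotv (F i) v.
Proof.
rewrite /dotv [RHS]exchange_big /=; apply: eq_bigr => c _.
by rewrite summxE mulr_suml.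
Qed.

Lemma dotvDr u v w : dotv u (v + w) = dotv u v + dotv u w.
Proof. by rewrite dotvC dotvDl 2!(dotvC u). Qed.

Lemma dotvBr u v w : dotv u (v - w) = dotv u v - dotv u w.
Proof. by rewrite dotvC dotvBl 2!(dotvC u). Qed.

Lemma dotvZr c u v : dotv u (c *: v) = c * dotv u v.
Proof. by rewrite dotvC dotvZl dotvC. Qed.

Lemma dotv_sumr (I : finType) u (F : I -> 'cV[R]_N) :
  dotv u (\sum_i F i) = \sum_i dotv u (F i).
Proof. by rewrite dotvC dotv_suml; apply: eq_bigr => i _; rewrite dotvC. Qed.

Lemma dotv_delta u j : dotv u (delta_mx j 0) = u j 0.
Proof.
rewrite /dotv (bigD1 j) //= big1 => [|i ij]; rewrite mxE eqxx.
  by rewrite eqxx mulr1 addr0.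
by rewrite (negbTE ij) mulr0.
Qed.

Lemma dotv0 u : dotv u 0 = 0.
Proof. by rewrite -[X in dotv _ X](scale0r 0) dotvZr mul0r. Qed.

End DotProduct.

(** * Derivatives of sums, projections and scalar products *)

Section SumDerivative.
Variables (R : realType) (V W : normedModType R) (I : finType).
Variables (f : I -> V -> W) (z : V).

Lemma differentiable_fsum :
  (forall i, differentiable (f i) z) ->
  differentiable (fun y => \sum_i f i y) z.
Proof.
move=> df; have -> : (fun y => \sum_i f i y) = \sum_i f i.
  by apply/funext => y; rewrite fct_sumE.
by elim/big_ind : _ => // *; exact: differentiableD.
Qed.

Lemma is_derive_fsum v (df : I -> W) :
  (forall i, is_derive z v (f i) (df i)) ->
  is_derive z v (fun y => \sum_i f i y) (\sum_i df i).
Proof.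
move=> Df; have -> : (fun y => \sum_i f i y) = \sum_i f i.
  by apply/funext => y; rewrite fct_sumE.
by elim/big_ind2 : _ => // *; [exact: is_derive_cst|exact: is_deriveD].
Qed.

End SumDerivative.

Section ProjectionDerivative.
Variables (R : realType) (V W : normedModType R) (y v : V * W).

Lemma differentiable_fst : differentiable (fst : V * W -> V) y.
Proof. by apply: linear_differentiable => ?; exact: cvg_fst. Qed.

Lemma differentiable_snd : differentiable (snd : V * W -> W) y.
Proof. by apply: linear_differentiable => ?; exact: cvg_snd. Qed.

Lemma is_derive_fst : is_derive y v fst v.1.
Proof.
apply: DeriveDef; first exact/diff_derivable/differentiable_fst.
rewrite deriveE ?diff_lin //; last exact: differentiable_fst.
by move=> ?; exact: cvg_fst.
Qed.

Lemma is_derive_snd : is_derive y v snd v.2.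
Proof.
apply: DeriveDef; first exact/diff_derivable/differentiable_snd.
rewrite deriveE ?diff_lin //; last exact: differentiable_snd.
by move=> ?; exact: cvg_snd.
Qed.

End ProjectionDerivative.

Section DotProductDerivative.
Variables (R : realType) (N : nat) (V : normedModType R).
Implicit Types f g : V -> 'cV[R]_N.

Lemma differentiable_entry f i z :
  differentiable f z -> differentiable (fun y => f y i 0 : R) z.
Proof.
by move=> df; apply: (differentiable_comp df (differentiable_coord _ _ _)).
Qed.

Lemma differentiable_dotv f g z :
  (forall i, differentiable (fun y => f y i 0 : R) z) ->
  (forall i, differentiable (fun y => g y i 0 : R) z) ->
  differentiable (fun y => dotv (f y) (g y)) z.
Proof.
by move=> df dg; apply: differentiable_fsum => i; apply: differentiableM.
Qed.

Lemma is_derive_entry f i z v df :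
  is_derive z v f df -> is_derive z v (fun y => f y i 0 : R) (df i 0).
Proof.
move=> [fzv <-]; apply: DeriveDef; first exact: (derivable_mxP _ _ _).1.
by rewrite derive_mx // mxE.
Qed.

Lemma is_derive_dotv f g z v df dg :
  is_derive z v f df -> is_derive z v g dg ->
  is_derive z v (fun y => dotv (f y) (g y)) (dotv df (g z) + dotv (f z) dg).
Proof.
move=> Df Dg; rewrite addrC -big_split; apply: is_derive_fsum => i.
apply: is_derive_eq.
  by apply: is_deriveM; apply: is_derive_entry.
by rewrite [df i 0 * _]mulrC.
Qed.

End DotProductDerivative.

(** The differential of [f] at [z] also gives the first-order expansion of [g], and a differential
    is unique. This moves differentiability between functions that agree only near a point. *)
Lemma near_eq_differentiable (R : realType) (V W : normedModType R)
    (f g : V -> W) (z : V) :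
  (\near z, f z = g z) -> differentiable f z -> differentiable g z.
Proof.
move=> fg df; have [dfc dfo] := (diff_locallyP _ _).1 df.
have dgo : g \o shift z = cst (g z) + 'd f z +o_ 0 id.
  apply/eqaddoP => eps eps0; have /eqaddoP/(_ eps eps0) := dfo.
  apply: filterS2; last exact: (nbhs0P _ _).1 fg.
  move=> y /= fgy.
  by rewrite !fctE /= [y + z]addrC fgy (nbhs_singleton fg).
by apply/diff_locallyP; rewrite (diff_unique dfc dgo).
Qed.

(** * Chain rule through a pair of stages *)

Section ChainRule.
Variables (R : realType) (N : nat) (V : normedModType R).
Variables (Q P : V -> 'cV[R]_N) (z : V).
Hypotheses (dQ : differentiable Q z) (dP : differentiable P z).
Variable g : phase R N -> R.
Hypothesis dg : differentiable g (Q z, P z).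

Lemma differentiable_comp_pair : differentiable (fun y => g (Q y, P y)) z.
Proof. exact: (differentiable_comp (differentiable_pair dQ dP) dg). Qed.

(** The gradients collect derivatives along basis vectors, so linearity of the differential on the
    basis expansion of [(u, v)] suffices. *)
Lemma diff_grad (u v : 'cV[R]_N) :
  'd g (Q z, P z) (u, v) =
  dotv (grad1 g (Q z, P z)) u + dotv (grad2 g (Q z, P z)) v.
Proof.
have -> : (u, v) = \sum_i u i 0 *: ((delta_mx i 0, 0) : phase R N)
                 + \sum_i v i 0 *: ((0, delta_mx i 0) : phase R N).
  apply: injective_projections; rewrite /= !raddf_sum /=.
    rewrite [X in _ + X]big1 ?addr0 => [|i _]; last exact: scaler0.
    by rewrite [LHS]matrix_sum_delta; apply: eq_bigr => i _; rewrite big_ord1.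
  rewrite [X in X + _]big1 ?add0r => [|i _]; last exact: scaler0.
  by rewrite [LHS]matrix_sum_delta; apply: eq_bigr => i _; rewrite big_ord1.
rewrite linearD !linear_sum; congr (_ + _); apply: eq_bigr => i _;
  by rewrite linearZ mxE deriveE // mulrC.
Qed.

Lemma is_derive_comp_pair v :
  is_derive z v (fun y => g (Q y, P y))
    (dotv (grad1 g (Q z, P z)) ('D_v Q z)
     + dotv (grad2 g (Q z, P z)) ('D_v P z)).
Proof.
have dQP := differentiable_pair dQ dP.
apply: DeriveDef; first exact/diff_derivable/differentiable_comp_pair.
rewrite deriveE; last exact: differentiable_comp_pair.
rewrite (diff_comp dQP dg) /= (diff_pair dQ dP).
by rewrite diff_grad !deriveE.
Qed.

End ChainRule.

(** * Deterministic partitioned Runge-Kutta step over a finite index set *)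

Section PartitionedRungeKutta.
Variables (R : realType) (N : nat) (X : finType).
Variables (a abar ahat : X -> X -> R) (alpha alphahat : X -> R).
Hypothesis symp : forall x y,
  alpha x * abar x y + alpha y * a y x = alpha x * alpha y.
Hypothesis symp_force : forall x y,
  alpha x * ahat x y + alphahat y * a y x = alpha x * alphahat y.

(* [Y], [F] are the values of dh/dq and of the force at the stages; [dq], [dX],
   [dQ] are variations of q_k, of dh/dp and of the stages Q. *)
Lemma prk_variation (p0 p1 dq : 'cV[R]_N) (P Y F dX dQ : X -> 'cV[R]_N) :
  (forall x, P x = p0 - \sum_y abar x y *: Y y + \sum_y ahat x y *: F y) ->
  p1 = p0 - \sum_y alpha y *: Y y + \sum_y alphahat y *: F y ->
  (forall x, dQ x = dq + \sum_y a x y *: dX y) ->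
  dotv p1 dq
  + \sum_x alpha x * (dotv (p1 - P x) (dX x) + dotv (Y x) (dQ x)) =
  dotv p0 dq + \sum_x alphahat x * dotv (F x) (dQ x).
Proof.
move=> EP Ep EQ; pose Z y := alphahat y *: F y - alpha y *: Y y.
have pZ : p1 = p0 + \sum_y Z y by rewrite Ep sumrB addrAC addrA.
have aPZ x : alpha x *: (p1 - P x) = \sum_y a y x *: Z y.
  (* [p0] is common to [p1] and [P x]; what remains are differences of weights, which the order
     conditions control after multiplication by [alpha x]. *)
  have -> : p1 - P x = \sum_y ((alphahat y - ahat x y) *: F y
                               - (alpha y - abar x y) *: Y y).
    rewrite pZ EP -[p0 - _ + _]addrA opprD addrACA subrr add0r opprD opprK.
    rewrite -sumrN -!big_split; apply: eq_bigr => y _ /=.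
    by rewrite !scalerBl opprB [_ - ahat x y *: _]addrC addrACA [- _ + _]addrC.
  rewrite scaler_sumr; apply: eq_bigr => y _.
  have E1 : alpha x * (alphahat y - ahat x y) = a y x * alphahat y.
    by rewrite mulrBr -symp_force addrC addKr mulrC.
  have E2 : alpha x * (alpha y - abar x y) = a y x * alpha y.
    by rewrite mulrBr -symp addrC addKr mulrC.
  by rewrite !scalerBr !scalerA E1 E2.
(* Exchanging sums pairs [Z y] with [\sum_x a y x *: dX x], which the stage variation identifies
   with [dQ y - dq]. *)
have -> : \sum_x alpha x * (dotv (p1 - P x) (dX x) + dotv (Y x) (dQ x)) =
    \sum_y (dotv (Z y) (dQ y - dq) + alpha y * dotv (Y y) (dQ y)).
  under eq_bigr do rewrite mulrDr -dotvZl aPZ dotv_suml.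
  rewrite !big_split; congr (_ + _); rewrite exchange_big /=.
  apply: eq_bigr => y _; rewrite EQ addrC addKr dotv_sumr.
  by apply: eq_bigr => x _; rewrite dotvZl dotvZr.
(* The [dq] terms cancel against those coming from [p1], and the [Y] part of [Z y] cancels the other
   [Y] term, so only the force survives. *)
rewrite pZ dotvDl dotv_suml -addrA -big_split; congr (_ + _).
apply: eq_bigr => y _ /=.
by rewrite dotvBr addrA [dotv _ dq + _]addrC subrK dotvBl !dotvZl subrK.
Qed.

Variables (h : X -> phase R N -> R) (F : X -> phase R N -> 'cV[R]_N).
Hypothesis h2 : forall x, C2 (h x).
Variables (U : set (phase R N)) (Q P : X -> phase R N -> 'cV[R]_N).
Variables p0 q1 : phase R N -> 'cV[R]_N.
Hypothesis oU : open U.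
Hypothesis dQ : forall x z, U z -> differentiable (Q x) z.
Hypothesis dP : forall x z, U z -> differentiable (P x) z.

Let w x z := (Q x z, P x z).

Hypothesis QE : forall z, U z -> forall x,
  Q x z = z.1 + \sum_y a x y *: grad2 (h y) (w y z).
Hypothesis PE : forall z, U z -> forall x,
  P x z = p0 z - \sum_y abar x y *: grad1 (h y) (w y z)
               + \sum_y ahat x y *: F y (w y z).
Hypothesis q1E : forall z, U z ->
  q1 z = z.1 + \sum_y alpha y *: grad2 (h y) (w y z).
Hypothesis p1E : forall z, U z ->
  z.2 = p0 z - \sum_y alpha y *: grad1 (h y) (w y z)
             + \sum_y alphahat y *: F y (w y z).

(** The discrete Hamiltonian with the time step and the increments absorbed into [alpha]. *)
Definition prk_hamiltonian z : R :=
  dotv z.2 (q1 z)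
  - \sum_x alpha x * (dotv (P x z) (grad2 (h x) (w x z)) - h x (w x z)).

(* Substituting q1 eliminates its derivative from the computation. *)
Let K z : R := dotv z.2 z.1
  + \sum_x alpha x * (dotv (z.2 - P x z) (grad2 (h x) (w x z)) + h x (w x z)).

Lemma prk_hamiltonianE z : U z -> K z = prk_hamiltonian z.
Proof.
move=> Uz; rewrite /prk_hamiltonian q1E // dotvDr dotv_sumr -addrA -sumrB.
congr (_ + _); apply: eq_bigr => x _.
by rewrite dotvZr dotvBl -mulrBr opprB addrA addrAC.
Qed.

Lemma near_prk_hamiltonianE z : U z -> \near z, K z = prk_hamiltonian z.
Proof.
move=> Uz; apply: filterS (open_nbhs_nbhs (conj oU Uz)).
exact: prk_hamiltonianE.
Qed.

(** Second-order smoothness enters here: an entry of [grad2] is a directional derivative of [h x],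
    itself [C1]. *)
Lemma differentiable_stage_grad2 x z i :
  U z -> differentiable (fun y => grad2 (h x) (w x y) i 0 : R) z.
Proof.
move=> Uz; have -> : (fun y => grad2 (h x) (w x y) i 0 : R) =
    (fun y => 'D_(0, delta_mx i 0) (h x) (Q x y, P x y)).
  by apply/funext => y; rewrite mxE.
have [_ /(_ (0, delta_mx i 0))[dh _]] := h2 x.
by have dw := differentiable_comp_pair (dQ x Uz) (dP x Uz) (dh _); exact: dw.
Qed.

Lemma is_derive_stage_grad2 x z v : U z ->
  is_derive z v (fun y => grad2 (h x) (w x y))
    ('D_v (fun y => grad2 (h x) (w x y)) z).
Proof.
move=> Uz; apply: derivableP; apply/derivable_mxP => i j; rewrite ord1.
exact/diff_derivable/differentiable_stage_grad2.
Qed.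

Lemma differentiable_prk_hamiltonian z :
  U z -> differentiable prk_hamiltonian z.
Proof.
move=> Uz; apply: (near_eq_differentiable (near_prk_hamiltonianE Uz)).
apply: differentiableD.
  apply: differentiable_dotv => i; apply: differentiable_entry.
    exact: differentiable_snd.
  exact: differentiable_fst.
apply: differentiable_fsum => x; apply: differentiableM.
  exact: differentiable_cst.
apply: differentiableD; last first.
  have dh : differentiable (h x) (w x z) by have [[]] := h2 x.
  by have dw := differentiable_comp_pair (dQ x Uz) (dP x Uz) dh; exact: dw.
apply: differentiable_dotv => i; last exact: differentiable_stage_grad2.
apply: differentiable_entry; apply: differentiableB; last exact: dP.
exact: differentiable_snd.
Qed.

(** Basis directions [v] isolate the entries of [q1] and [p0], so this one formula yields both
    integrator equations. *)
Lemma derive_prk_hamiltonian z v : U z ->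
  'D_v prk_hamiltonian z =
  dotv v.2 (q1 z) + dotv (p0 z) v.1
  + \sum_x alphahat x * dotv (F x (w x z)) ('D_v (Q x) z).
Proof.
move=> Uz; rewrite -(near_eq_derive _ (near_prk_hamiltonianE Uz)).
have DQ x : 'D_v (Q x) z =
    v.1 + \sum_y a x y *: 'D_v (fun z => grad2 (h y) (w y z)) z.
  (* The stage equation holds on the open set [U], hence near [z], and can be differentiated
     there. *)
  have QE' : \near z, z.1 + \sum_y a x y *: grad2 (h y) (w y z) = Q x z.
    by apply: filterS (open_nbhs_nbhs (conj oU Uz)) => ? /QE ->.
  apply: (@derive_val _ _ _ _ _ _ _ (near_eq_is_derive QE' _)).
  apply: is_deriveD; first exact: is_derive_fst.
  apply: is_derive_fsum => y; apply: is_deriveZ.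
  exact: is_derive_stage_grad2.
have DK : is_derive z v K (dotv v.2 z.1 + dotv z.2 v.1
    + \sum_x alpha x * (dotv (v.2 - 'D_v (P x) z) (grad2 (h x) (w x z))
       + dotv (z.2 - P x z) ('D_v (fun z => grad2 (h x) (w x z)) z)
       + (dotv (grad1 (h x) (w x z)) ('D_v (Q x) z)
          + dotv (grad2 (h x) (w x z)) ('D_v (P x) z)))).
  apply: is_deriveD.
    by apply: is_derive_dotv; [exact: is_derive_snd|exact: is_derive_fst].
  apply: is_derive_fsum => x; apply: is_deriveZ; apply: is_deriveD.
    apply: is_derive_dotv; last exact: is_derive_stage_grad2.
    apply: is_deriveB; first exact: is_derive_snd.
    exact/derivableP/diff_derivable/dP.
  have dh : differentiable (h x) (w x z) by have [[]] := h2 x.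
  by have dw := is_derive_comp_pair (dQ x Uz) (dP x Uz) dh v; exact: dw.
rewrite derive_val q1E // -[RHS]addrA.
(* The variation identity is used from right to left, with [z.2] as [p1], [v.1] as [dq], and
   derivatives along [v] as the other variations. *)
rewrite -(prk_variation (PE Uz) (p1E Uz) DQ).
rewrite dotvDr dotv_sumr -!addrA; congr (_ + _); rewrite addrCA; congr (_ + _).
rewrite -big_split; apply: eq_bigr => x _ /=.
rewrite dotvZr -mulrDr; congr (_ * _).
(* The terms in ['D_v (P x) z] from the product rule and from the chain rule for [h x] have opposite
   signs and cancel. *)
rewrite [dotv (v.2 - _) _]dotvBl [dotv ('D_v (P x) z) _]dotvC.
by rewrite [X in _ + X]addrC addrACA subrK.
Qed.

End PartitionedRungeKutta.

(** Entries of the discrete forces thus become scalar products of forces with directional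
    derivatives of stages, the form taken by the work terms. *)
Lemma mul_tr_jac1 (R : realType) (N : nat) (g : phase R N -> 'cV[R]_N) z u j :
  differentiable g z ->
  ((jac1 g z)^T *m u) j 0 = dotv u ('D_(delta_mx j 0, 0) g z).
Proof.
move=> dg; rewrite mxE; apply: eq_bigr => i _; rewrite !mxE mulrC.
have D := derivableP (diff_derivable dg : derivable g z (delta_mx j 0, 0)).
by rewrite (@derive_val _ _ _ _ _ _ _ (is_derive_entry i D)).
Qed.

Lemma mul_tr_jac2 (R : realType) (N : nat) (g : phase R N -> 'cV[R]_N) z u j :
  differentiable g z ->
  ((jac2 g z)^T *m u) j 0 = dotv u ('D_(0, delta_mx j 0) g z).
Proof.
move=> dg; rewrite mxE; apply: eq_bigr => i _; rewrite !mxE mulrC.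
have D := derivableP (diff_derivable dg : derivable g z (0, delta_mx j 0)).
by rewrite (@derive_val _ _ _ _ _ _ _ (is_derive_entry i D)).
Qed.

(** * Absorbing the time step and the increments into the coefficients *)

Section DrivenTerms.
Variables (R : realType) (m s : nat) (dt : R) (dW : 'I_m -> R).

(* [None] stands for time and [Some r] for the r-th Wiener process. *)
Definition driven (T : Type) (t : T) (w : 'I_m -> T) (k : option 'I_m) : T :=
  if k is Some r then w r else t.

(** Both the increment and the choice between [c] and [e] follow the driving process of [x]. For
    matrix coefficients [c] and [e] are rows, so [x] is the column index. *)
Definition folded (c e : 'I_s -> R) (x : option 'I_m * 'I_s) : R :=
  driven dt dW x.1 * driven c (fun=> e) x.1 x.2.

Lemma folded_sum (V : lmodType R) c e (G : option 'I_m -> 'I_s -> V) :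
  \sum_x folded c e x *: G x.1 x.2 =
  dt *: (\sum_i c i *: G None i) + \sum_r dW r *: \sum_i e i *: G (Some r) i.
Proof.
rewrite -(pair_bigA _ (fun k i => folded c e (k, i) *: G k i)) big_option.
by congr (_ + _); [|apply: eq_bigr => r _]; rewrite scaler_sumr;
  apply: eq_bigr => i _; rewrite scalerA.
Qed.

Lemma folded_sumr c e (G : option 'I_m -> 'I_s -> R) :
  \sum_x folded c e x * G x.1 x.2 =
  dt * (\sum_i c i * G None i) + \sum_r dW r * \sum_i e i * G (Some r) i.
Proof. exact: (@folded_sum R^o). Qed.

(** The increments of [x] and [y] are a common factor; choosing time or noise for each of the two
    processes leaves exactly the four hypotheses. Hamiltonian and forcing conditions are both
    instances. *)
Lemma folded_symplectic (A B M L : 'M[R]_s) (c e f g : 'I_s -> R) :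
  (forall i j, [/\ c i * M i j + f j * A j i = c i * f j,
                   e i * L i j + g j * B j i = e i * g j,
                   e i * M i j + f j * B j i = e i * f j &
                   c i * L i j + g j * A j i = c i * g j]) ->
  forall x y,
    folded c e x * folded (M x.2) (L x.2) y
    + folded f g y * folded (A y.2) (B y.2) x = folded c e x * folded f g y.
Proof.
move=> H [k i] [l j]; have [H1 H2 H3 H4] := H i j; rewrite /folded.
rewrite [X in X + _]mulrACA [X in _ + X = _]mulrACA [RHS]mulrACA.
rewrite [driven dt dW l * _]mulrC -mulrDr; congr (_ * _).
by case: k l => [r|] [r'|] /=.
Qed.

End DrivenTerms.

(** * The stochastic step at a fixed sample point *)

Theorem theorem3p4 (R : realType) (d : measure_display) (T : measurableType d)
    (Pr : probability T R) (N m s : nat)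
    (sys : forced_system R N m) (hsys : standing_assumptions sys)
    (W : 'I_m -> R -> {RV Pr >-> R}) (hW : standard_wiener W)
    (C : prk_tableau R s) (hC : prk_conditions C)
    (tk dt : R) (htk : 0 <= tk) (hdt : 0 < dt) (omega : T)
    (U : set (phase R N)) (hU : open U)
    (Q P : 'I_s -> phase R N -> 'cV[R]_N) (pk qk1 : phase R N -> 'cV[R]_N)
    (hQ : forall i z, U z -> differentiable (Q i) z)
    (hP : forall i z, U z -> differentiable (P i) z) :
  let dW r := W r (tk + dt) omega - W r tk omega in
  (forall z, U z ->
     prk_step sys C dt dW (Q^~ z) (P^~ z) z.1 (pk z) (qk1 z) z.2) ->
  lagrange_dAlembert_integrator
    (discrete_hamiltonian sys C dt dW Q P qk1)
    (discrete_force_minus sys C dt dW Q P)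
    (discrete_force_plus sys C dt dW Q P)
    U pk qk1.
Proof.
move=> dW step.
pose h (x : option 'I_m * 'I_s) := driven (ham sys) (sham sys) x.1.
pose F (x : option 'I_m * 'I_s) := driven (force sys) (sforce sys) x.1.
pose fold := @folded R m s dt dW.
(* A row enters only through its stage, because each stage is repeated for every driving process;
   the increment belongs to the column. *)
pose fold_mx (A B : 'M[R]_s) (x : option 'I_m * 'I_s) := fold (A x.2) (B x.2).
pose a := fold_mx (coef_a C) (coef_b C).
pose abar := fold_mx (coef_abar C) (coef_bbar C).
pose ahat := fold_mx (coef_ahat C) (coef_bhat C).
pose alpha := fold (coef_alpha C) (coef_beta C).
pose alphahat := fold (coef_alphahat C) (coef_betahat C).
pose Qx (x : option 'I_m * 'I_s) := Q x.2.
pose Px (x : option 'I_m * 'I_s) := P x.2.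
have symp x y : alpha x * abar x y + alpha y * a y x = alpha x * alpha y.
  by apply: folded_symplectic => i j; have [] := hC i j.
have symp_force x y :
    alpha x * ahat x y + alphahat y * a y x = alpha x * alphahat y.
  (* The forcing conditions come in another order than the lemma expects, hence the regrouping. *)
  apply: folded_symplectic => i j; by have [_ []] := hC i j; split.
have h2 x : C2 (h x).
  have [[hamC2 shamC2] _ _ _] := hsys.
  by case: x => [[r|] i]; [exact: (shamC2 r)|exact: hamC2].
have dQ x z (Uz : U z) : differentiable (Qx x) z by exact: hQ.
have dP x z (Uz : U z) : differentiable (Px x) z by exact: hP.
pose G2 z k i := grad2 (driven (ham sys) (sham sys) k) (Q i z, P i z).
pose G1 z k i := grad1 (driven (ham sys) (sham sys) k) (Q i z, P i z).
pose GF z k i := driven (force sys) (sforce sys) k (Q i z, P i z).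
have QE z (Uz : U z) x :
    Qx x z = z.1 + \sum_y a x y *: grad2 (h y) (Qx y z, Px y z).
  have [E _ _ _] := step z Uz.
  by rewrite [LHS]E (folded_sum dt dW _ _ (G2 z)) addrA.
have PE z (Uz : U z) x :
    Px x z = pk z - \sum_y abar x y *: grad1 (h y) (Qx y z, Px y z)
                  + \sum_y ahat x y *: F y (Qx y z, Px y z).
  have [_ E _ _] := step z Uz.
  rewrite [LHS]E (folded_sum dt dW _ _ (G1 z)) (folded_sum dt dW _ _ (GF z)).
  by rewrite opprD !addrA.
have q1E z (Uz : U z) :
    qk1 z = z.1 + \sum_y alpha y *: grad2 (h y) (Qx y z, Px y z).
  have [_ _ E _] := step z Uz.
  by rewrite [LHS]E (folded_sum dt dW _ _ (G2 z)) addrA.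
have p1E z (Uz : U z) :
    z.2 = pk z - \sum_y alpha y *: grad1 (h y) (Qx y z, Px y z)
               + \sum_y alphahat y *: F y (Qx y z, Px y z).
  have [_ _ _ E] := step z Uz.
  rewrite [LHS]E (folded_sum dt dW _ _ (G1 z)) (folded_sum dt dW _ _ (GF z)).
  by rewrite opprD !addrA.
have -> : discrete_hamiltonian sys C dt dW Q P qk1 =
    prk_hamiltonian alpha h Qx Px qk1.
  apply/funext => z; rewrite /discrete_hamiltonian -addrA -opprD.
  by rewrite -(folded_sumr _ _ _ _ (fun k i => dotv (P i z) (G2 z k i)
    - driven (ham sys) (sham sys) k (Q i z, P i z))).
(* Serves both discrete forces: [J] is either family of Jacobians and [v] the matching basis
   direction. *)
have forceE z (J : 'I_s -> 'M[R]_N) v j :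
    (forall i u, ((J i)^T *m u) j 0 = dotv u ('D_v (Q i) z)) ->
    (dt *: (\sum_i coef_alphahat C i *: ((J i)^T *m force sys (Q i z, P i z)))
     + \sum_r dW r *: \sum_i coef_betahat C i *:
         ((J i)^T *m sforce sys r (Q i z, P i z))) j 0 =
    \sum_x alphahat x * dotv (F x (Qx x z, Px x z)) ('D_v (Qx x) z).
  move=> JE.
  rewrite -(folded_sum dt dW _ _ (fun k i => (J i)^T *m GF z k i)) summxE.
  by apply: eq_bigr => x _; rewrite mxE JE.
have dH := derive_prk_hamiltonian symp symp_force h2 hU dQ dP QE PE q1E p1E.
move=> z Uz; split.
- exact: (differentiable_prk_hamiltonian h2 hU dQ dP q1E Uz).
(* Along [(0, delta_mx j 0)] the [pk] term vanishes and the [qk1] term is its entry [j]; the work of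
   the forces is entry [j] of the discrete force and cancels. *)
- apply/colP => j; rewrite 3!mxE dH //= dotv0 addr0 dotvC dotv_delta.
  rewrite (forceE z (fun i => jac2 (Q i) z) (0, delta_mx j 0)) ?addrK //.
  by move=> i u; exact: (mul_tr_jac2 u j (hQ i z Uz)).
- apply/colP => j; rewrite 3!mxE dH //= [dotv 0 _]dotvC dotv0 add0r dotv_delta.
  rewrite (forceE z (fun i => jac1 (Q i) z) (delta_mx j 0, 0)) ?addrK //.
  by move=> i u; exact: (mul_tr_jac1 u j (hQ i z Uz)).
Qed.
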